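(* For all integers $h\ge2$ and all $a>0$ there is $b=b(a,h)>0$ such that the following holds. Let $n^{-a}\le\varepsilon<1/2$ and suppose $G$ is an $(\varepsilon,h)$-quasirandom graph on $[n]$ with $3N-3m$ edges. Run the triangle removal process from $G=\mathbf{G}(m)$, producing $\mathbf{G}(m),\mathbf{G}(m+1),\dots$, and let $\mathbf{M}$ be the freezing index. Then with probability $1-o(1)$, $\mathbf{M}\ge(1-\varepsilon^{b})N$ and moreover for each $m\le i\le(1-\varepsilon^{b})N$ the graph $\mathbf{G}(i)$ is $(\varepsilon^{b},h)$-quasirandom.
   Context: Throughout, $n\equiv1$ or $3\pmod 6$, $N=\binom n2/3$ (so $K_n$ has $3N$ edges), and asymptotics are as $n\to\infty$. The triangle removal process from $G$: starting with $\mathbf{G}(m)=G$, for each $i\ge m$, $\mathbf{G}(i+1)$ is obtained from $\mathbf{G}(i)$ by deleting the three edges of a triangle chosen uniformly at random among all triangles of $\mathbf{G}(i)$; if $\mathbf{G}(\mathbf{M})$ is the first graph in the sequence with no triangles, the process is frozen: $\mathbf{G}(i)=\mathbf{G}(\mathbf{M})$ for all $i\ge\mathbf{M}$. For a graph $G$ with $n$ vertices and $e$ edges, $d(G)=e/\binom n2$, and $G$ is $(\varepsilon,h)$-quasirandom if every set $A$ of at most $h$ vertices satisfies $\left|\bigcap_{w\in A}N_G(w)\right|=(1\pm\varepsilon)d(G)^{|A|}n$, where $x=1\pm\varepsilon$ means $1-\varepsilon\le x\le1+\varepsilon$. *)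

(* Defs.v *)
From HB Require Import structures.
From mathcomp Require Import all_boot all_order all_algebra.
From mathcomp Require Import reals exp.
Set Implicit Arguments. Unset Strict Implicit. Unset Printing Implicit Defensive.
Import Order.TTheory GRing.Theory Num.Theory.
Local Open Scope ring_scope.

Section TriangleRemoval.
Variable n : nat.

Definition graph := {set {set 'I_n}}.

Definition is_graph (E : graph) : Prop := forall e, e \in E -> #|e| = 2%N.

Definition adj (E : graph) (u v : 'I_n) : bool := [set u; v] \in E.

Definition NN : nat := 'C(n, 2) %/ 3.

Definition is_triangle (E : graph) (T : {set 'I_n}) : bool :=
  (#|T| == 3%N) && [forall u in T, forall v in T, (u != v) ==> adj E u v].

Definition triangles (E : graph) : {set {set 'I_n}} :=
  [set T | is_triangle E T].

Definition triangle_free (E : graph) : bool := triangles E == set0.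

Definition remove_triangle (E : graph) (T : {set 'I_n}) : graph :=
  E :\: [set e : {set 'I_n} | (e \subset T) && (#|e| == 2%N)].

Definition step_prob {R : realType} (E H : graph) : R :=
  if triangle_free E then (H == E)%:R
  else #|[set T in triangles E | remove_triangle E T == H]|%:R
       / #|triangles E|%:R.

(* Trajectory G(i), i >= m, encoded by G = G(m) and the tuple
   t = (G(m+1), ..., G(m+K)). *)
Definition traj (m K : nat) (G : graph) (t : K.-tuple graph) (i : nat) : graph :=
  if (i <= m)%N then G else nth G t (i - m - 1).

Definition traj_prob {R : realType} (m K : nat) (G : graph)
  (t : K.-tuple graph) : R :=
  \prod_(j < K) step_prob (traj m G t (m + j)) (traj m G t (m + j).+1).

Definition freeze_index (m K : nat) (G : graph) (t : K.-tuple graph) : nat :=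
  (m + find (fun j => triangle_free (traj m G t (m + j))) (iota 0 K.+1))%N.

Definition traj_Pr {R : realType} (m K : nat) (G : graph)
  (A : K.-tuple graph -> bool) : R :=
  \sum_(t : K.-tuple graph | A t) traj_prob m G t.

Definition density {R : realType} (E : graph) : R := #|E|%:R / ('C(n, 2))%:R.

Definition common_nbhd (E : graph) (A : {set 'I_n}) : {set 'I_n} :=
  [set v | [forall w in A, adj E w v]].

Definition quasirandom {R : realType} (eps : R) (h : nat) (E : graph) : bool :=
  [forall A : {set 'I_n}, (#|A| <= h)%N ==>
    ((1 - eps) * density E ^+ #|A| * n%:R <= #|common_nbhd E A|%:R) &&
    (#|common_nbhd E A|%:R <= (1 + eps) * density E ^+ #|A| * n%:R)].

End TriangleRemoval.

(* Main.v *)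
Require Import Defs.
From HB Require Import structures.
From mathcomp Require Import all_boot all_order all_algebra.
From mathcomp Require Import zify ring lra.
From mathcomp Require Import reals sequences exp.
Import Order.TTheory GRing.Theory Num.Theory.
Local Open Scope ring_scope.

(* While the process is quasirandom with relative error eta, a set A of k vertices
   loses from its common neighbourhood, in expectation at each step, a proportion
   (1 +- O(eta)) 3k / |E|.  So the common neighbourhoods follow the trajectory
   p^k n, p being the density, as soon as the permitted relative error grows like
   a large power of 1 / p: no self-correction is needed, because eps^b is much
   larger than eps * p^(-C) while p >= eps^b.  Deviations are controlled by the
   sum over A of exp(lambda (upper barrier violation)) and
   exp(lambda (lower barrier violation)); it is a supermartingale while the graph
   is quasirandom, is at least 1 when some barrier is violated, and starts at
   about n^h exp(- eps^3 n / 48), up to constants. *)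

(** * The trajectory of the process *)

Lemma step_prob_ge0 {R : realType} {n} (E H : graph n) :
  0 <= step_prob E H :> R.
Proof.
by rewrite /step_prob; case: ifP => _; rewrite ?divr_ge0 ?ler0n.
Qed.

(** The expectation of [F] after one step: grouping the triangles by the graph that they leave turns
    [step_prob] into an average over triangles. *)
Lemma sum_step_prob {R : realType} {n} (E : graph n) (F : graph n -> R) :
  \sum_H step_prob E H * F H =
  if triangle_free E then F E
  else (\sum_(S in triangles E) F (remove_triangle E S)) / #|triangles E|%:R.
Proof.
rewrite /step_prob; case: ifP => _.
  rewrite (bigD1 E) //= eqxx mul1r big1 ?addr0 // => H /negPf ->.
  by rewrite mul0r.
rewrite (partition_big (remove_triangle E) predT) //= mulr_suml.
apply: eq_bigr => H _.
rewrite mulrAC; congr (_ / _).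
rewrite (eq_bigr (fun=> F H)); last by move=> S /andP[_ /eqP ->].
rewrite sumr_const mulr_natl; congr (_ *+ _).
by apply: eq_card => S; rewrite in_set unfold_in.
Qed.

Lemma step_prob_total {R : realType} {n} (E : graph n) :
  \sum_H step_prob E H = 1 :> R.
Proof.
under eq_bigr do rewrite -[step_prob _ _]mulr1.
rewrite (sum_step_prob E (fun=> 1)); case: ifP => // /negbT.
rewrite -card_gt0 => h.
by rewrite sumr_const -mulr_natl mulr1 divff // pnatr_eq0 -lt0n.
Qed.

Lemma traj_prob_ge0 {R : realType} {n} m K (G : graph n)
    (t : K.-tuple (graph n)) :
  0 <= traj_prob m G t :> R.
Proof. by apply: prodr_ge0 => j _; apply: step_prob_ge0. Qed.

Lemma traj0 {n} m K (G : graph n) (t : K.-tuple (graph n)) : traj m G t m = G.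
Proof. by rewrite /traj leqnn. Qed.

Lemma traj_cons {n} m K (G H : graph n) (t : K.-tuple (graph n)) j :
  (j <= K)%N -> traj m G [tuple of H :: t] (m + j.+1) = traj m.+1 H t (m.+1 + j).
Proof.
move=> jK; rewrite /traj.
have -> : (m + j.+1 <= m)%N = false by lia.
have -> : (m + j.+1 - m - 1 = j)%N by lia.
case: j jK => [|j] jK; first by rewrite addn0 leqnn.
have -> : (m.+1 + j.+1 <= m.+1)%N = false by lia.
have -> : (m.+1 + j.+1 - m.+1 - 1 = j)%N by lia.
(* [traj] uses its starting graph as the default of [nth], so the two defaults differ; [j] is below
   the length, and neither is reached. *)
by apply: set_nth_default; rewrite size_tuple.
Qed.

Lemma traj_prob_cons {R : realType} {n} m K (G H : graph n)
    (t : K.-tuple (graph n)) :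
  traj_prob m G [tuple of H :: t] = step_prob G H * traj_prob m.+1 H t :> R.
Proof.
rewrite /traj_prob big_ord_recl /=.
have := traj_cons m K G H t 0 (leq0n K); rewrite addn1 addn0 traj0 => e0.
rewrite addn0 traj0 e0; congr (_ * _); apply: eq_bigr => -[j /= jK] _.
by rewrite /bump leq0n add1n -addnS !traj_cons ?addnS // ltnW.
Qed.

(** The Markov property: conditioning on the first step moves the start to [m.+1] and allows
    induction on [K]. *)
Lemma traj_Pr_recl {R : realType} {n} m K (G : graph n)
    (A : K.+1.-tuple (graph n) -> bool) :
  traj_Pr m G A =
  \sum_H step_prob G H * traj_Pr m.+1 H (fun t => A [tuple of H :: t]) :> R.
Proof.
under eq_bigr do rewrite /traj_Pr big_distrr /=.
rewrite pair_big_dep /= /traj_Pr.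
rewrite (reindex (fun p : graph n * K.-tuple (graph n) =>
  [tuple of p.1 :: p.2])) /=.
  by apply: eq_bigr => -[H t] _ /=; rewrite traj_prob_cons.
exists (fun t : K.+1.-tuple (graph n) => (thead t, [tuple of behead t])) => /=.
  by move=> [H t] _ /=; congr pair; apply: val_inj.
by move=> t _; rewrite [RHS]tuple_eta.
Qed.

Lemma traj_Pr_total {R : realType} {n} m K (G : graph n) :
  traj_Pr m G (fun _ : K.-tuple (graph n) => true) = 1 :> R.
Proof.
elim: K m G => [|K IH] m G; last first.
  rewrite traj_Pr_recl -[RHS](@step_prob_total _ _ G).
  by apply: eq_bigr => H _; rewrite IH mulr1.
rewrite /traj_Pr (bigD1 [tuple]) //= big1 ?addr0 => [|t]; last first.
  by rewrite (tuple0 t) => /eqP.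
by rewrite /traj_prob big_ord0.
Qed.

Lemma le_traj_Pr {R : realType} {n} m K (G : graph n)
    (A B : K.-tuple (graph n) -> bool) :
  (forall t, A t -> B t) -> traj_Pr m G A <= traj_Pr m G B :> R.
Proof.
move=> AB; rewrite /traj_Pr [leRHS]big_mkcond [leLHS]big_mkcond /=.
apply: ler_sum => t _; case: ifPn => [/AB -> //|_].
by case: ifP => _ //; apply: traj_prob_ge0.
Qed.

Lemma traj_PrC {R : realType} {n} m K (G : graph n)
    (A : K.-tuple (graph n) -> bool) :
  traj_Pr m G A = 1 - traj_Pr m G (fun t => ~~ A t) :> R.
Proof.
rewrite -(@traj_Pr_total R n m K G) /traj_Pr (bigID A xpredT) /=.
by rewrite addrK.
Qed.

(* A maximal inequality of Ville type: [Phi] needs to be a supermartingale only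
   while the process is [ok], because the first failure already forces
   [1 <= Phi]. *)
Lemma escape_bound {R : realType} {n} (live : pred nat)
    (ok : nat -> graph n -> bool) (inv : nat -> graph n -> Prop)
    (Phi : nat -> graph n -> R) :
  (forall i, live i.+1 -> live i) ->
  (forall i E, 0 <= Phi i E) ->
  (forall i E, live i -> inv i E -> ~~ ok i E -> 1 <= Phi i E) ->
  (forall i E S, ok i E -> inv i E -> S \in triangles E ->
     inv i.+1 (remove_triangle E S)) ->
  (forall i E, ok i E -> ~~ triangle_free E) ->
  (forall i E, live i.+1 -> inv i E -> ok i E ->
     (\sum_(S in triangles E) Phi i.+1 (remove_triangle E S))
       / #|triangles E|%:R <= Phi i E) ->
  forall K m G, inv m G ->
  traj_Pr m G (fun t : K.-tuple (graph n) =>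
    [exists j : 'I_K.+1,
       live (m + j)%N && ~~ ok (m + j)%N (traj m G t (m + j))]) <= Phi m G.
Proof.
move=> live_pred Phi_ge0 Phi_bad inv_step ok_tri Phi_step.
have live_le i j : live (i + j)%N -> live i.
  by elim: j => [|j IH]; rewrite ?addn0 ?addnS // => /live_pred/IH.
(* Liveness never returns once lost, so from such a start the event is empty. *)
have never K m G : ~~ live m -> traj_Pr m G (fun t : K.-tuple (graph n) =>
    [exists j : 'I_K.+1,
       live (m + j)%N && ~~ ok (m + j)%N (traj m G t (m + j))]) = 0 :> R.
  move=> nl; apply: big1_seq => t /andP[/existsP[j /andP[/live_le]]].
  by rewrite (negPf nl).
elim=> [|K IH] m G invG.
  have [lm|nl] := boolP (live m); last by rewrite never.
  have [okG|nok] := boolP (ok m G).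
    rewrite /traj_Pr big1_seq // => t /andP[/existsP[j]].
    by rewrite [j]ord1 addn0 traj0 okG andbF.
  apply: (le_trans _ (Phi_bad _ _ lm invG nok)).
  by rewrite -(@traj_Pr_total R n m 0 G); apply: le_traj_Pr.
have [lm|nl] := boolP (live m); last by rewrite never.
have [okG|nok] := boolP (ok m G); last first.
  apply: (le_trans _ (Phi_bad _ _ lm invG nok)).
  by rewrite -(@traj_Pr_total R n m K.+1 G); apply: le_traj_Pr.
rewrite traj_Pr_recl.
pose A H := fun t : K.-tuple (graph n) => [exists j : 'I_K.+1,
  live (m.+1 + j)%N && ~~ ok (m.+1 + j)%N (traj m.+1 H t (m.+1 + j))].
(* As [G] is [ok], a failure cannot occur at [j = 0]; it is a failure of the process started from
   [H] at time [m.+1]. *)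
have le1 : \sum_H step_prob G H * traj_Pr m.+1 H (fun t : K.-tuple _ =>
    [exists j : 'I_K.+2,
    live (m + j)%N && ~~ ok (m + j)%N (traj m G [tuple of H :: t] (m + j))])
    <= \sum_H step_prob G H * traj_Pr m.+1 H (A H) :> R.
  apply: ler_sum => H _; apply: ler_wpM2l; first exact: step_prob_ge0.
  apply: le_traj_Pr => t /existsP[[[|j] jK] /=].
    by rewrite addn0 traj0 okG andbF.
  rewrite traj_cons // addnS -addSn => h.
  by apply/existsP; exists (Ordinal (jK : (j < K.+1)%N)).
apply: (le_trans le1); rewrite sum_step_prob (negPf (ok_tri _ _ okG)).
have [lm1|nl1] := boolP (live m.+1).
  apply: le_trans (Phi_step _ _ lm1 invG okG).
  rewrite ler_wpM2r ?invr_ge0 ?ler0n // ler_sum // => S ST.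
  by apply: IH; apply: inv_step ST.
by rewrite big1 ?mul0r // => S _; apply: never.
Qed.

(** * Counting triangles *)

Section TriangleCounts.
Context {n : nat}.
Implicit Types (E : graph n) (A S e : {set 'I_n}) (u v w : 'I_n).

Lemma adjC E u v : adj E u v = adj E v u.
Proof. by rewrite /adj setUC. Qed.

Lemma adj_neq {E u v} : is_graph E -> adj E u v -> u != v.
Proof.
by move=> gE /gE /eqP; rewrite cards2; case: (u != v).
Qed.

Lemma mem_common_nbhd E A v :
  reflect (forall w, w \in A -> adj E w v) (v \in common_nbhd E A).
Proof. by rewrite inE; apply: forall_inP. Qed.

Lemma common_nbhd_notin {E A v} :
  is_graph E -> v \in common_nbhd E A -> v \notin A.
Proof.
move=> gE /mem_common_nbhd vA; apply/negP => /vA /(adj_neq gE).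
by rewrite eqxx.
Qed.

Lemma triangleP E S :
  reflect (#|S| = 3%N /\ {in S &, forall u v, u != v -> adj E u v})
          (S \in triangles E).
Proof.
rewrite inE; apply: (iffP andP) => [[/eqP cS /forall_inP h]|[cS h]].
  split=> // u v uS vS; apply/implyP.
  by have /forall_inP := h _ uS; apply.
split; first exact/eqP.
by apply/forall_inP => u uS; apply/forall_inP => v vS; apply/implyP/h.
Qed.

Lemma triangle_edge {E S e} :
  S \in triangles E -> e \subset S -> #|e| = 2%N -> e \in E.
Proof.
move=> /triangleP[_ h] eS /eqP/cards2P[u [v [uv ee]]].
have: {subset e <= S} by apply/subsetP.
by rewrite ee => hs; apply: (h u v) => //; apply: hs; rewrite !inE eqxx ?orbT.
Qed.

Lemma is_graph_remove E S : is_graph E -> is_graph (remove_triangle E S).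
Proof. by move=> gE e /setDP[/gE]. Qed.

Lemma card_remove_triangle E S :
  S \in triangles E -> (#|remove_triangle E S| + 3 = #|E|)%N.
Proof.
move=> ST; have [cS _] := triangleP _ _ ST.
have sub : [set e : {set 'I_n} | (e \subset S) && (#|e| == 2%N)] \subset E.
  by apply/subsetP => e; rewrite inE => /andP[eS /eqP]; exact: (triangle_edge ST eS).
have <- : #|[set e : {set 'I_n} | (e \subset S) && (#|e| == 2%N)]| = 3%N.
  by rewrite cards_draws cS.
by rewrite /remove_triangle cardsDS // subnK // subset_leq_card.
Qed.

(** A triangle through [u] and [v] is determined by its third vertex. *)
Lemma card_triangles_at_edge {E u v} : is_graph E -> adj E u v ->
  #|[set S in triangles E | (u \in S) && (v \in S)]| =
  #|common_nbhd E [set u; v]|.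
Proof.
move=> gE uv; have nuv := adj_neq gE uv.
rewrite -(card_in_imset (f := fun w => w |: [set u; v])
  (D := common_nbhd E [set u; v])); last first.
  move=> w1 w2 /(common_nbhd_notin gE) h1 _ eqw.
  have : w1 \in w2 |: [set u; v] by rewrite -eqw setU11.
  by rewrite in_setU1 (negPf h1) orbF => /eqP.
congr #|pred_of_set _|; apply/setP => S; apply/idP/imsetP.
  rewrite inE => /andP[/triangleP[cS hS] /andP[uS vS]].
  have sub : [set u; v] \subset S by rewrite subUset !sub1set uS.
  have /cards1P[w Sw] : #|S :\: [set u; v]| == 1%N.
    by rewrite cardsDS // cS cards2 nuv.
  have : w \in S :\: [set u; v] by rewrite Sw set11.
  rewrite inE => /andP[wuv wS]; exists w.
    apply/mem_common_nbhd => x xuv; apply: hS => //.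
      exact: (subsetP sub).
    by apply: contraNneq wuv => <-.
  by rewrite -{1}(setID S [set u; v]) (setIidPr sub) Sw setUC.
move=> [w wN ->]; have wn := common_nbhd_notin gE wN.
move/mem_common_nbhd: wN => wN.
have uw : adj E u w by apply: wN; rewrite set21.
have vw : adj E v w by apply: wN; rewrite set22.
rewrite inE; apply/andP; split; last by rewrite !inE !eqxx !orbT.
apply/triangleP; split; first by rewrite cardsU1 wn cards2 nuv.
move=> x y; rewrite !inE => /or3P[]/eqP-> /or3P[]/eqP->;
  by rewrite ?eqxx // adjC.
Qed.

(** Double counting of the pairs of a triangle and one of its edges. *)
Lemma card_triangles E : is_graph E ->
  (3 * #|triangles E| = \sum_(e in E) #|common_nbhd E e|)%N.
Proof.
move=> gE.
transitivity (\sum_(S in triangles E) \sum_(e in E) (e \subset S : nat))%N.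
  rewrite mulnC -sum_nat_const; apply: eq_bigr => S ST.
  have [cS _] := triangleP _ _ ST.
  have -> : (3 = #|[set e : {set 'I_n} | (e \subset S) && (#|e| == 2%N)]|)%N.
    by rewrite cards_draws cS.
  rewrite -sum1_card big_mkcond [RHS]big_mkcond; apply: eq_bigr => e _.
  rewrite inE; case: ifPn => [/andP[eS /eqP /(triangle_edge ST eS) ->]|].
    by rewrite eS.
  case: ifP => // eE; rewrite (eqP (introT eqP (gE _ eE))) eqxx andbT.
  by move=> /negPf ->.
rewrite exchange_big /=; apply: eq_bigr => e eE.
have /eqP/cards2P[u [v [uv ee]]] := gE _ eE.
rewrite {e eE uv}ee in eE * => //.
rewrite -(card_triangles_at_edge gE eE) -sum1_card -big_mkcondr /=.
rewrite [RHS](eq_bigl (fun S => (S \in triangles E) && ([set u; v] \subset S))).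
  by [].
by move=> S; rewrite inE subUset !sub1set.
Qed.

(** An edge from [v] to some [w] in [A] is deleted exactly when both ends lie in [S]. *)
Lemma lost_common_nbhd E A S : is_graph E -> S \in triangles E ->
  common_nbhd E A :\: common_nbhd (remove_triangle E S) A =
  [set v in common_nbhd E A | (v \in S) && (S :&: A != set0)].
Proof.
move=> gE ST; apply/setP => v; rewrite in_setD andbC [RHS]inE.
 case vQ: (v \in common_nbhd E A) => //=.
have /mem_common_nbhd vA : v \in common_nbhd E A by rewrite vQ.
apply/idP/idP.
  rewrite inE => /forall_inPn[w wA]; rewrite /adj !inE.
  rewrite [_ \in E](vA w wA) andbT negbK subUset !sub1set.
  move=> /andP[/andP[wS ->] _] /=.
  by apply/set0Pn; exists w; rewrite inE wS.
move=> /andP[vS /set0Pn[w]]; rewrite inE => /andP[wS wA].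
rewrite inE; apply/forall_inPn; exists w => //.
rewrite /adj !inE negb_and negbK subUset !sub1set wS vS /=.
by rewrite (eqP (introT eqP (gE _ (vA w wA)))) eqxx.
Qed.

Lemma common_nbhd_remove_sub E A S :
  common_nbhd (remove_triangle E S) A \subset common_nbhd E A.
Proof.
apply/subsetP => v /mem_common_nbhd h; apply/mem_common_nbhd => w /h.
by rewrite /adj inE => /andP[].
Qed.

Definition lost E A S : {set 'I_n} :=
  [set v in common_nbhd E A | (v \in S) && (S :&: A != set0)].

Lemma card_common_nbhd_remove E A S : is_graph E -> S \in triangles E ->
  (#|common_nbhd (remove_triangle E S) A| + #|lost E A S| =
   #|common_nbhd E A|)%N.
Proof.
move=> gE ST; rewrite /lost -lost_common_nbhd //.
rewrite cardsDS ?common_nbhd_remove_sub // subnKC //.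
exact/subset_leq_card/common_nbhd_remove_sub.
Qed.

Lemma card_lost E A S : S \in triangles E -> (#|lost E A S| <= 3)%N.
Proof.
move=> /triangleP[<- _]; apply/subset_leq_card/subsetP => v.
by rewrite inE => /and3P[].
Qed.

(** For [v] in the common neighbourhood of [A], the number of triangles whose removal expels [v]
    from it. *)
Definition hits E A v : nat :=
  #|[set S in triangles E | (v \in S) && (S :&: A != set0)]|.

Lemma sum_lost E A :
  (\sum_(S in triangles E) #|lost E A S| =
   \sum_(v in common_nbhd E A) hits E A v)%N.
Proof.
transitivity (\sum_(S in triangles E) \sum_(v in common_nbhd E A)
   ((v \in S) && (S :&: A != set0) : nat))%N.
  apply: eq_bigr => S _; rewrite -big_mkcondr sum1dep_card.
  by apply: eq_card => v; rewrite !inE.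
rewrite exchange_big /=; apply: eq_bigr => v _.
by rewrite -big_mkcondr sum1dep_card.
Qed.

(** Both sides count the pairs [(w, S)] with [w] in [A] and [S] a triangle through [v] and [w]. *)
Lemma sum_codegree E A v : is_graph E -> v \in common_nbhd E A ->
  (\sum_(w in A) #|common_nbhd E [set v; w]| =
   \sum_(S in triangles E | v \in S) #|S :&: A|)%N.
Proof.
move=> gE /mem_common_nbhd vA.
transitivity (\sum_(w in A) \sum_(S in triangles E | v \in S) (w \in S : nat))%N.
  apply: eq_bigr => w wA.
  rewrite -card_triangles_at_edge //; last by rewrite adjC vA.
  rewrite -big_mkcondr sum1dep_card; apply: eq_card => S.
  by rewrite !in_set -andbA.
rewrite exchange_big /=; apply: eq_bigr => S _.
rewrite -big_mkcondr sum1dep_card; apply: eq_card => w.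
by rewrite !inE andbC.
Qed.

Lemma card_triangle_setI E A S v : S \in triangles E -> v \in S ->
  v \notin A -> (#|S :&: A| <= 2)%N.
Proof.
move=> /triangleP[cS _] vS vA.
have : (#|S :&: A| <= #|S :\ v|)%N.
  apply/subset_leq_card/subsetP => w; rewrite !inE => /andP[-> wA].
  by rewrite andbT; apply: contraNneq vA => <-.
by move: (cardsD1 v S); rewrite cS vS add1n => -[<-].
Qed.

Lemma hits_le E A v : is_graph E -> v \in common_nbhd E A ->
  (hits E A v <= \sum_(w in A) #|common_nbhd E [set v; w]|)%N.
Proof.
move=> gE vA; rewrite sum_codegree // /hits -sum1dep_card big_mkcondr.
rewrite [leqRHS]big_mkcondr /=; apply: leq_sum => S _.
rewrite (fun_if (fun x => x)); case: (v \in S) => //=.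
by case: eqP => // /eqP; rewrite -card_gt0.
Qed.

(* Only the triangles made of [v] and two vertices of [A] are counted twice on
   the left. *)
Lemma le_hits E A v : is_graph E -> v \in common_nbhd E A ->
  (\sum_(w in A) #|common_nbhd E [set v; w]| <= hits E A v + 'C(#|A|, 2))%N.
Proof.
move=> gE vA; have vnA := common_nbhd_notin gE vA.
rewrite sum_codegree //.
apply: (@leq_trans (\sum_(S in triangles E | v \in S)
   ((S :&: A != set0 : nat) + (#|S :&: A| == 2%N : nat)))).
  apply: leq_sum => S /andP[ST vS].
  have := card_triangle_setI _ _ _ _ ST vS vnA.
  by rewrite -card_gt0; case: #|_| => [|[|[|]]].
rewrite big_split /= leq_add //.
  rewrite /hits -sum1dep_card -big_mkcondr /=.
  by rewrite leq_eqVlt; apply/orP; left; apply/eqP/eq_bigl => S; rewrite andbA.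
rewrite -big_mkcondr sum1dep_card -cards_draws.
(* A triangle through [v] meeting [A] twice consists of [v] and that pair, so these triangles inject
   into the pairs of [A]. *)
rewrite -(card_in_imset (f := fun S => S :&: A)
   (D := [set S | (S \in triangles E) && (v \in S) && (#|S :&: A| == 2%N)])).
  apply/subset_leq_card/subsetP => e /imsetP[S SD ->].
  by move: SD; rewrite !inE => /andP[_ ->]; rewrite subsetIr.
move=> S1 S2 /[!in_set] /andP[/andP[T1 v1] c1] /andP[/andP[T2 v2] c2] eqS.
have h S : is_triangle E S -> v \in S -> #|S :&: A| == 2%N ->
    S = v |: (S :&: A).
  move=> TS vS /eqP c; have /triangleP[cS _] : S \in triangles E by rewrite inE.
  apply/esym/eqP.
  rewrite eqEcard cardsU1 inE (negPf vnA) andbF c cS leqnn andbT.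
  by rewrite subUset sub1set vS subsetIl.
by rewrite (h _ T1 v1 c1) [S1 :&: A]eqS -(h _ T2 v2 c2).
Qed.

End TriangleCounts.

(** * Elementary inequalities *)

Lemma le1_of_expr_le_half {R : realFieldType} (x : R) k :
  x ^+ k <= 2^-1 -> x <= 1.
Proof.
move=> xk; case: leP => // x1.
have : 1 <= x ^+ k by apply: exprn_ege1; apply: ltW.
by lra.
Qed.

(** Invert [1 - y <= expR (- y)] and use [(1 - y) * (1 + y + 2 * y^2) = 1 + y^2 * (1 - 2 * y)]. *)
Lemma expR_le_quadratic {R : realType} (y : R) :
  y <= 2^-1 -> expR y <= 1 + y + 2 * y ^+ 2.
Proof.
move=> hy; have h1 : 1 - y <= expR (- y) by apply: expR_ge1Dx.
have y1 : 0 < 1 - y by lra.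
rewrite -[y in leLHS]opprK expRN.
apply: (@le_trans _ _ (1 - y)^-1); first by rewrite lef_pV2 ?posrE ?expR_gt0.
rewrite -[leLHS]mul1r ler_pdivrMr //.
have := sqr_ge0 y; nra.
Qed.

(** Because [x <= 3], the quadratic term [2 * c^2 * x^2] is at most [6 * c^2 * x], so only the mean
    of [x] matters. The number [c] may have either sign. *)
Lemma mean_expR_le {R : realType} {T : finType} (P : {set T}) (x : T -> nat)
    (c : R) : (0 < #|P|)%N -> (forall S, S \in P -> (x S <= 3)%N) ->
  3 * c <= 2^-1 ->
  (\sum_(S in P) expR (c * (x S)%:R)) / #|P|%:R <=
  expR (c * (1 + 6 * c) * ((\sum_(S in P) x S)%N%:R / #|P|%:R)).
Proof.
move=> P0 x3 c3; have P0R : (0 : R) < #|P|%:R by rewrite ltr0n.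
apply: le_trans (expR_ge1Dx _).
rewrite ler_pdivrMr // mulrDl mul1r -!mulrA mulVf ?gt_eqF // mulr1.
rewrite natr_sum !mulr_sumr -sumr_const -big_split /=.
apply: ler_sum => S /x3 xS.
have x0 : (0 : R) <= (x S)%:R by [].
have {}xS : (x S)%:R <= 3 :> R by rewrite ler_nat.
apply: le_trans (expR_le_quadratic _ _) _; first by nra.
have : 0 <= c ^+ 2 * ((x S)%:R * (3 - (x S)%:R)).
  by rewrite mulr_ge0 ?sqr_ge0 // mulr_ge0 // subr_ge0.
nra.
Qed.

Lemma expr_1B_ge {R : realFieldType} (u : R) k : 0 <= u <= 1 ->
  1 - k%:R * u <= (1 - u) ^+ k.
Proof.
move=> hu; elim: k => [|k IH]; first by rewrite expr0 mul0r subr0.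
rewrite exprS -natr1; have k0 : (0 : R) <= k%:R by [].
have h : (1 - u) * (1 - k%:R * u) <= (1 - u) * (1 - u) ^+ k.
  by rewrite ler_wpM2l // subr_ge0; case/andP: hu.
apply: le_trans h; have : 0 <= k%:R * u ^+ 2 by rewrite mulr_ge0 ?sqr_ge0.
nra.
Qed.

Lemma expr_1B_le {R : realFieldType} (u : R) k : 0 <= u <= 1 ->
  (1 - u) ^+ k <= 1 - k%:R * u + (k%:R * u) ^+ 2.
Proof.
move=> hu; elim: k => [|k IH]; first by rewrite expr0 mul0r; lra.
rewrite exprS -natr1; have k0 : (0 : R) <= k%:R by [].
have h : (1 - u) * (1 - u) ^+ k <= (1 - u) * (1 - k%:R * u + (k%:R * u) ^+ 2).
  by rewrite ler_wpM2l // subr_ge0; case/andP: hu.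
apply: (le_trans h); move/andP: hu => [u0 u1].
have : 0 <= k%:R ^+ 2 * u ^+ 3 by rewrite mulr_ge0 ?sqr_ge0 ?exprn_ge0.
have : 0 <= k%:R * u ^+ 2 by rewrite mulr_ge0 ?sqr_ge0.
have := sqr_ge0 u; nra.
Qed.

Lemma expr_1B_inv_ge {R : realFieldType} (u : R) k : 0 <= u < 1 ->
  1 + k%:R * u <= ((1 - u) ^+ k)^-1.
Proof.
move=> /andP[u0 u1]; elim: k => [|k IH]; first by rewrite expr0 mul0r invr1 addr0.
have k0 : (0 : R) <= k%:R by [].
have i1 : 1 + u <= (1 - u)^-1.
  rewrite -[leRHS]mul1r ler_pdivlMr ?subr_gt0 //.
  have := sqr_ge0 u; nra.
rewrite exprS invfM -natr1.
apply: (@le_trans _ _ ((1 + u) * (1 + k%:R * u))).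
  have : 0 <= k%:R * u ^+ 2 by rewrite mulr_ge0 ?sqr_ge0.
  nra.
by apply: ler_pM => //; rewrite addr_ge0 // mulr_ge0.
Qed.

(* The relative error [eta] grows by the factor [(1 - u) ^- C] while the target
   [V] decreases by [(1 - u) ^+ k]. *)
Section ThresholdStep.
Context {R : realFieldType} (V eta u : R) (k C : nat).
Hypotheses (V0 : 0 <= V) (eta0 : 0 <= eta) (u01 : 0 <= u < 1) (kC : (k <= C)%N).

(** The net factor is [(1 - u)^-(C - k)]: the allowed absolute deviation widens although the target
    shrinks. *)
Let grow : eta * (1 + (C - k)%N%:R * u) <=
  eta / (1 - u) ^+ C * (1 - u) ^+ k.
Proof.
have /andP[u0 u1] := u01.
have nz j : (1 - u) ^+ j != 0 by rewrite expf_neq0 // gt_eqF // subr_gt0.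
rewrite -mulrA ler_wpM2l // -{2}(subnK kC) exprD invfM -mulrA mulVf // mulr1.
exact: expr_1B_inv_ge.
Qed.

(** The barriers fall by about [V * u * k], the expected loss. The widening [eta * (C - k)] slows
    the upper barrier and speeds up the lower one, which pays for the errors in that loss. *)
Lemma upper_threshold_step :
  (1 + eta) * V - (1 + eta / (1 - u) ^+ C) * (V * (1 - u) ^+ k) <=
  V * u * (k%:R - eta * (C - k)%N%:R).
Proof.
have /andP[u0 u1] := u01.
have h1 := expr_1B_ge u k; rewrite u0 ltW // in h1; have {}h1 := h1 isT.
have h2 : 0 <= V * (eta / (1 - u) ^+ C * (1 - u) ^+ k -
    eta * (1 + (C - k)%N%:R * u) + ((1 - u) ^+ k - (1 - k%:R * u))).
  by rewrite mulr_ge0 // addr_ge0 // subr_ge0.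
nra.
Qed.

Lemma lower_threshold_step :
  V * u * (k%:R - k%:R * (k%:R * u) + eta * (C - k)%N%:R) <=
  (1 - eta) * V - (1 - eta / (1 - u) ^+ C) * (V * (1 - u) ^+ k).
Proof.
have /andP[u0 u1] := u01.
have h1 := expr_1B_le u k; rewrite u0 ltW // in h1; have {}h1 := h1 isT.
have h2 : 0 <= V * (eta / (1 - u) ^+ C * (1 - u) ^+ k -
    eta * (1 + (C - k)%N%:R * u) + (1 - k%:R * u + (k%:R * u) ^+ 2 -
    (1 - u) ^+ k)).
  by rewrite mulr_ge0 // addr_ge0 // subr_ge0.
nra.
Qed.
End ThresholdStep.

(** * Expected loss of a common neighbourhood *)

Lemma quasirandomP {R : realType} {n} (eps : R) h (E : graph n) :
  reflect (forall A : {set 'I_n}, (#|A| <= h)%N ->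
    (1 - eps) * (density E ^+ #|A| * n%:R) <= #|common_nbhd E A|%:R <=
    (1 + eps) * (density E ^+ #|A| * n%:R)) (quasirandom eps h E).
Proof.
apply: (iffP forallP) => q A; first by move/(implyP (q A)); rewrite !mulrA.
by apply/implyP => /q; rewrite !mulrA.
Qed.

Lemma density_ge0 {R : realType} {n} (E : graph n) : 0 <= density E :> R.
Proof. exact: divr_ge0. Qed.

Lemma quasirandom_le {R : realType} {n} (e1 e2 : R) h (E : graph n) :
  e1 <= e2 -> quasirandom e1 h E -> quasirandom e2 h E.
Proof.
move=> e12 /quasirandomP q; apply/quasirandomP => A /q /andP[l u].
have d0 : (0 : R) <= density E ^+ #|A| * n%:R.
  by rewrite mulr_ge0 // exprn_ge0 // density_ge0.
apply/andP; split.
  by apply: le_trans l; rewrite ler_wpM2r // lerD2l lerN2.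
by apply: (le_trans u); rewrite ler_wpM2r // lerD2l.
Qed.

Section MeanLoss.
Context {R : realType} {n h : nat} {eta : R} {E : graph n}.
Hypotheses (h2 : (2 <= h)%N) (gE : is_graph E) (qE : quasirandom eta h E).
Hypotheses (eta0 : 0 <= eta) (eta1 : eta < 1).

Let codeg : R := density E ^+ 2 * n%:R.

Lemma quasirandom_codegree u v : u != v ->
  (1 - eta) * codeg <= #|common_nbhd E [set u; v]|%:R <= (1 + eta) * codeg.
Proof.
by move=> uv; have := quasirandomP _ _ _ qE [set u; v]; rewrite cards2 uv; apply.
Qed.

Lemma quasirandom_triangles :
  (1 - eta) * codeg * #|E|%:R <= 3 * #|triangles E|%:R
    <= (1 + eta) * codeg * #|E|%:R.
Proof.
rewrite -natrM card_triangles // natr_sum mulr_natr mulr_natr -!sumr_const.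
apply/andP; split; apply: ler_sum => e /gE /eqP/cards2P[u [v [uv ->]]];
  by have /andP[] := quasirandom_codegree _ _ uv.
Qed.

Hypothesis codeg0 : 0 < codeg.
Hypothesis E0 : (0 < #|E|)%N.
Let codeg_ge0 : 0 <= codeg := ltW codeg0.

Lemma quasirandom_triangles_gt0 : (0 < #|triangles E|)%N.
Proof.
rewrite -(ltr0n R) -(pmulr_rgt0 (x := 3)) //.
have /andP[h3 _] := quasirandom_triangles.
by apply: (lt_le_trans _ h3); rewrite mulr_gt0 ?ltr0n // mulr_gt0 // subr_gt0.
Qed.

Variable A : {set 'I_n}.
Hypothesis Ah : (#|A| <= h)%N.
Let k := #|A|.
Let V : R := density E ^+ k * n%:R.

Let V0 : 0 <= V.
Proof. by rewrite /V mulr_ge0 // exprn_ge0 // density_ge0. Qed.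

Let sum_codeg v : v \in common_nbhd E A ->
  k%:R * ((1 - eta) * codeg)
    <= (\sum_(w in A) #|common_nbhd E [set v; w]|)%N%:R
    <= k%:R * ((1 + eta) * codeg).
Proof.
move=> vA; have vnA := common_nbhd_notin gE vA.
have vw w : w \in A -> v != w by apply: contraTneq => <-.
rewrite natr_sum mulr_natl mulr_natl -!sumr_const.
by apply/andP; split; apply: ler_sum => w /vw/quasirandom_codegree/andP[].
Qed.

Let loss := (\sum_(S in triangles E) #|lost E A S|)%N.

Let lossE : loss%:R = \sum_(v in common_nbhd E A) (hits E A v)%:R :> R.
Proof. by rewrite /loss sum_lost natr_sum. Qed.

(** At most [(1 + eta) * V] vertices are each hit by at most [k * (1 + eta) * codeg] triangles, out
    of at least [(1 - eta) * codeg * #|E| / 3]; [codeg] cancels. *)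
Lemma mean_loss_le : loss%:R / #|triangles E|%:R <=
  3 * V / #|E|%:R * (k%:R * ((1 + eta) ^+ 2 / (1 - eta))).
Proof.
have T0 : (0 : R) < #|triangles E|%:R by rewrite ltr0n quasirandom_triangles_gt0.
have e0 : (0 : R) < #|E|%:R by rewrite ltr0n.
have h3 : loss%:R <= (1 + eta) * V * (k%:R * ((1 + eta) * codeg)).
  have /andP[_ Q] := quasirandomP _ _ _ qE A Ah.
  apply: (@le_trans _ _ (#|common_nbhd E A|%:R * (k%:R * ((1 + eta) * codeg)))).
    rewrite lossE mulr_natl -sumr_const; apply: ler_sum => v vA.
    have /andP[_] := sum_codeg _ vA; apply: le_trans.
    by rewrite ler_nat hits_le.
  by rewrite ler_wpM2r // mulr_ge0 // mulr_ge0 // addr_ge0.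
have /andP[h4 _] := quasirandom_triangles.
rewrite ler_pdivrMr //; apply: (le_trans h3).
have -> : (1 + eta) * V * (k%:R * ((1 + eta) * codeg)) =
    V / #|E|%:R * (k%:R * ((1 + eta) ^+ 2 / (1 - eta))) *
    ((1 - eta) * codeg * #|E|%:R).
  by field; rewrite !gt_eqF // subr_gt0.
have -> : 3 * V / #|E|%:R * (k%:R * ((1 + eta) ^+ 2 / (1 - eta))) *
    #|triangles E|%:R = V / #|E|%:R * (k%:R * ((1 + eta) ^+ 2 / (1 - eta))) *
    (3 * #|triangles E|%:R).
  by ring.
apply: ler_wpM2l => //.
by rewrite mulr_ge0 ?divr_ge0 // mulr_ge0 // divr_ge0 ?sqr_ge0 // subr_ge0 ltW.
Qed.

Lemma mean_loss_ge : k%:R <= eta * codeg ->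
  3 * V / #|E|%:R * (k%:R * (1 - 4 * eta)) <= loss%:R / #|triangles E|%:R.
Proof.
move=> kc.
have T0 : (0 : R) < #|triangles E|%:R by rewrite ltr0n quasirandom_triangles_gt0.
have e0 : (0 : R) < #|E|%:R by rewrite ltr0n.
(* For [eta >= 1 / 4] the claimed bound is nonpositive; otherwise [1 - 2 * eta] is positive. *)
have [eta4|eta4] := leP 1 (4 * eta).
  apply: (@le_trans _ _ 0); last by rewrite divr_ge0.
  apply: mulr_ge0_le0; first by rewrite divr_ge0 // mulr_ge0.
  by apply: mulr_ge0_le0; rewrite ?subr_le0.
have h3 : (1 - eta) * V * (k%:R * ((1 - 2 * eta) * codeg)) <= loss%:R.
  have /andP[Q _] := quasirandomP _ _ _ qE A Ah.
  apply: (@le_trans _ _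
      (#|common_nbhd E A|%:R * (k%:R * ((1 - 2 * eta) * codeg)))).
    rewrite ler_wpM2r // mulr_ge0 // mulr_ge0 //; lra.
  rewrite lossE mulr_natl -sumr_const; apply: ler_sum => v vA.
  have /andP[h5 _] := sum_codeg _ vA.
  have h6 : (\sum_(w in A) #|common_nbhd E [set v; w]|)%N%:R <=
      (hits E A v)%:R + 'C(k, 2)%:R :> R by rewrite -natrD ler_nat le_hits.
  (* The doubly counted triangles cost one more [eta], whence the factor [1 - 2 * eta]. *)
  have h7 : 'C(k, 2)%:R <= k%:R * (eta * codeg).
    apply: (@le_trans _ _ (k%:R * k%:R)); last by rewrite ler_wpM2l.
    rewrite -natrM ler_nat bin2 -divn2.
    by rewrite (leq_trans (leq_div _ _)) // leq_mul2l leq_pred orbT.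
  nra.
have /andP[_ h4] := quasirandom_triangles.
rewrite ler_pdivlMr //; apply: le_trans h3.
have -> : 3 * V / #|E|%:R * (k%:R * (1 - 4 * eta)) * #|triangles E|%:R =
    V / #|E|%:R * (k%:R * (1 - 4 * eta)) * (3 * #|triangles E|%:R) by ring.
apply: (@le_trans _ _ (V / #|E|%:R * (k%:R * (1 - 4 * eta)) *
    ((1 + eta) * codeg * #|E|%:R))).
  apply: ler_wpM2l => //; rewrite mulr_ge0 ?divr_ge0 // mulr_ge0 //; lra.
have -> : V / #|E|%:R * (k%:R * (1 - 4 * eta)) *
    ((1 + eta) * codeg * #|E|%:R) = V * k%:R * codeg * ((1 - 4 * eta) * (1 + eta)).
  by field; rewrite gt_eqF.
have -> : (1 - eta) * V * (k%:R * ((1 - 2 * eta) * codeg)) =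
  V * k%:R * codeg * ((1 - eta) * (1 - 2 * eta)) by ring.
apply: ler_wpM2l; first by rewrite mulr_ge0 // mulr_ge0.
(* Both products equal [1 - 3 * eta] up to a multiple of [eta^2], which is [-4] on the left and [2]
   on the right. *)
have := sqr_ge0 eta; nra.
Qed.

End MeanLoss.

(** * One-step drift of the exponential weights *)

Section ExponentialDrift.
Context {R : realType} {n : nat} {E : graph n}.
Hypotheses (gE : is_graph E) (T0 : (0 < #|triangles E|)%N).
Variables (A : {set 'I_n}) (lam f f' : R).

Let mean_loss : R :=
  (\sum_(S in triangles E) #|lost E A S|)%N%:R / #|triangles E|%:R.

Let card_nbhd S : S \in triangles E ->
  #|common_nbhd (remove_triangle E S) A|%:R =
  #|common_nbhd E A|%:R - #|lost E A S|%:R :> R.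
Proof. by move=> ST; rewrite -(card_common_nbhd_remove E A S) // natrD addrK. Qed.

(** Here [mean_expR_le] is applied with [c = - lam], and in [lower_drift] with [c = lam]. The
    second-order term changes the mean loss by the factor [1 - 6 * lam], respectively [1 + 6 * lam],
    which the fall of the barrier must respect. *)
Lemma upper_drift : 0 <= lam -> f - f' <= (1 - 6 * lam) * mean_loss ->
  (\sum_(S in triangles E)
     expR (lam * (#|common_nbhd (remove_triangle E S) A|%:R - f')))
    / #|triangles E|%:R <=
  expR (lam * (#|common_nbhd E A|%:R - f)).
Proof.
move=> lam0 ff.
have -> : \sum_(S in triangles E)
    expR (lam * (#|common_nbhd (remove_triangle E S) A|%:R - f')) =
    expR (lam * (#|common_nbhd E A|%:R - f')) *
    \sum_(S in triangles E) expR (- lam * #|lost E A S|%:R).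
  rewrite mulr_sumr; apply: eq_bigr => S ST.
  by rewrite -expRD card_nbhd //; congr expR; ring.
rewrite -mulrA; apply: le_trans (_ : expR (lam * (#|common_nbhd E A|%:R - f')) *
  expR (- lam * (1 + 6 * - lam) * mean_loss) <= _).
  rewrite ler_wpM2l ?expR_ge0 // mean_expR_le //; last by lra.
  by move=> S; apply: card_lost.
rewrite -expRD ler_expR.
have : 0 <= lam * ((1 - 6 * lam) * mean_loss - (f - f')).
  by rewrite mulr_ge0 // subr_ge0.
nra.
Qed.

Lemma lower_drift : 0 <= lam -> 6 * lam <= 1 ->
  (1 + 6 * lam) * mean_loss <= f - f' ->
  (\sum_(S in triangles E)
     expR (lam * (f' - #|common_nbhd (remove_triangle E S) A|%:R)))
    / #|triangles E|%:R <=
  expR (lam * (f - #|common_nbhd E A|%:R)).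
Proof.
move=> lam0 lam6 ff.
have -> : \sum_(S in triangles E)
    expR (lam * (f' - #|common_nbhd (remove_triangle E S) A|%:R)) =
    expR (lam * (f' - #|common_nbhd E A|%:R)) *
    \sum_(S in triangles E) expR (lam * #|lost E A S|%:R).
  rewrite mulr_sumr; apply: eq_bigr => S ST.
  by rewrite -expRD card_nbhd //; congr expR; ring.
rewrite -mulrA; apply: le_trans (_ : expR (lam * (f' - #|common_nbhd E A|%:R)) *
  expR (lam * (1 + 6 * lam) * mean_loss) <= _).
  rewrite ler_wpM2l ?expR_ge0 // mean_expR_le //; last by lra.
  by move=> S; apply: card_lost.
rewrite -expRD ler_expR.
have : 0 <= lam * (f - f' - (1 + 6 * lam) * mean_loss).
  by rewrite mulr_ge0 // subr_ge0.
nra.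
Qed.

End ExponentialDrift.

(** [L] is the expected loss, [W * k] its main term and [eps] the [6 * lam] of the drift lemmas. The
    surplus [eta * D >= 23 * k * eta] exceeds the total error of [(1 - eta) * (1 - 4 * eta)]. *)
Lemma upper_drift_margin {R : realFieldType} (W k D eps eta L : R) :
  0 <= W -> 0 <= k -> 23 * k <= D -> eps <= eta -> 0 <= eta <= 7 / 10 ->
  0 <= L -> W * (k * (1 - 4 * eta)) <= L ->
  W * (k - eta * D) <= (1 - eps) * L.
Proof.
move=> W0 k0 kD ee /andP[eta0 eta1] L0 WL.
have h1 : (1 - eta) * L <= (1 - eps) * L by rewrite ler_wpM2r // lerD2l lerN2.
apply: le_trans h1.
have h2 : W * (k - eta * D) <= W * (k * (1 - 23 * eta)).
  by apply: ler_wpM2l => //; have := ler_wpM2l eta0 kD; lra.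
apply: (le_trans h2).
have h3 : (1 - eta) * (W * (k * (1 - 4 * eta))) <= (1 - eta) * L.
  by apply: ler_wpM2l => //; lra.
apply: le_trans h3.
have : 0 <= W * k * (18 * eta + 4 * eta ^+ 2).
  by rewrite mulr_ge0 ?mulr_ge0 // addr_ge0 ?mulr_ge0 ?sqr_ge0.
nra.
Qed.

Lemma lower_drift_margin {R : realFieldType} (W k D v eps eta L : R) :
  0 <= W -> 0 <= k -> 23 * k <= D -> 0 <= eps <= eta -> 0 <= eta <= 7 / 10 ->
  v <= eta -> L <= W * (k * ((1 + eta) ^+ 2 / (1 - eta))) ->
  (1 + eps) * L <= W * (k - k * v + eta * D).
Proof.
move=> W0 k0 kD /andP[eps0 ee] /andP[eta0 eta1] ve LW.
have Q0 : 0 <= W * (k * ((1 + eta) ^+ 2 / (1 - eta))).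
  rewrite mulr_ge0 // mulr_ge0 // divr_ge0 ?sqr_ge0 //; lra.
apply: (@le_trans _ _ ((1 + eps) * (W * (k * ((1 + eta) ^+ 2 / (1 - eta)))))).
  by rewrite ler_wpM2l // addr_ge0.
apply: (@le_trans _ _ ((1 + eta) * (W * (k * ((1 + eta) ^+ 2 / (1 - eta)))))).
  by rewrite ler_wpM2r // lerD2l.
have -> : (1 + eta) * (W * (k * ((1 + eta) ^+ 2 / (1 - eta)))) =
    W * k * ((1 + eta) ^+ 3 / (1 - eta)) by rewrite exprS; ring.
(* The cap 7 / 10 comes from here: [18 - 25 * eta - eta^2] is barely positive there. With
   [v <= eta], the 22 becomes the constant 23. *)
have h1 : (1 + eta) ^+ 3 / (1 - eta) <= 1 + 22 * eta.
  rewrite ler_pdivrMr; last by lra.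
  have : 0 <= eta * (18 - 25 * eta - eta ^+ 2).
    by rewrite mulr_ge0 //; nra.
  rewrite !exprS expr0; nra.
apply: (@le_trans _ _ (W * k * (1 + 22 * eta))).
  by rewrite ler_wpM2l // mulr_ge0.
rewrite -mulrA ler_wpM2l //.
have := ler_wpM2l eta0 kD; have := ler_wpM2l k0 ve; nra.
Qed.

(** * The potential *)

Section Potential.
Context {R : realType} {n h m : nat} {theta : R}.
Let N := NN n.
Let eps : R := theta ^+ (96 * h).
Hypotheses (h2 : (2 <= h)%N) (binN : ('C(n, 2) = 3 * N)%N).
Hypotheses (theta0 : 0 < theta) (eps2 : eps <= 2^-1).
Hypothesis h_small_n : h%:R <= eps * (theta ^+ 2 * n%:R).
Hypothesis h_small_N : h%:R <= eps * (theta * N%:R).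

(* [eps] is the quasirandomness of the starting graph.  The exponent [24 * h] makes
   [err] grow fast enough to absorb every error in the drift of a common
   neighbourhood (the constant 23 in [lower_drift_margin]); the factor 9 / 8
   leaves room for random deviations, and the choice [eps = theta ^+ (96 * h)]
   keeps [err] below 7 / 10 and below [theta] for as long as the density of the
   graph is at least [theta]. *)
Definition steps_left i : R := (N - i)%:R.
Definition dens i : R := steps_left i / N%:R.
Definition err i : R := 9 / 8 * eps * (steps_left m / steps_left i) ^+ (24 * h).
Definition target i k : R := dens i ^+ k * n%:R.
Definition live i := theta * N%:R <= steps_left i.
Definition inv i (E : graph n) :=
  [/\ is_graph E, #|E| = (3 * (N - i))%N & (m <= i)%N].
Definition ok i (E : graph n) := quasirandom (err i) h E && ~~ triangle_free E.
(** The rate [eps / 6] makes the second-order correction [6 * lam] of the drift equal to [eps],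
    which [err i] dominates. *)
Definition Phi i (E : graph n) : R :=
  \sum_(A : {set 'I_n} | (#|A| <= h)%N)
    (expR (eps / 6 * (#|common_nbhd E A|%:R - (1 + err i) * target i #|A|)) +
     expR (eps / 6 * ((1 - err i) * target i #|A| - #|common_nbhd E A|%:R))).

Let eps0 : 0 < eps. Proof. exact: exprn_gt0. Qed.

Let h0 : (0 : R) < h%:R. Proof. by rewrite ltr0n ltnW. Qed.

Let n0 : (0 : R) < n%:R.
Proof.
have := lt_le_trans h0 h_small_n.
by rewrite pmulr_rgt0 // pmulr_rgt0 // exprn_gt0.
Qed.

Let N0 : (0 : R) < N%:R.
Proof. by have := lt_le_trans h0 h_small_N; rewrite !pmulr_rgt0. Qed.

Let theta1 : theta <= 1.
Proof. exact: le1_of_expr_le_half eps2. Qed.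

Let live_gt0 i : live i -> 0 < steps_left i.
Proof. by apply: lt_le_trans; rewrite mulr_gt0. Qed.

Let live_leN i : live i -> (i < N)%N.
Proof. by move/live_gt0; rewrite ltr0n subn_gt0. Qed.

Lemma live_pred i : live i.+1 -> live i.
Proof. by move=> l; apply: (le_trans l); rewrite ler_nat leq_sub2l. Qed.

Let dens_ge i : live i -> theta <= dens i.
Proof. by move=> l; rewrite ler_pdivlMr. Qed.

Let dens_gt0 i : live i -> 0 < dens i.
Proof. by move/dens_ge; apply: lt_le_trans. Qed.

Lemma density_inv i E : inv i E -> density E = dens i.
Proof.
case=> _ cE _; rewrite /density cE binN !natrM.
by rewrite -mulf_div divff ?pnatr_eq0 // mul1r.
Qed.

Let err_ge i : live i -> (m <= i)%N -> eps <= err i.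
Proof.
move=> l mi; rewrite /err; have l0 := live_gt0 _ l.
have h1 : 1 <= (steps_left m / steps_left i) ^+ (24 * h).
  by apply: exprn_ege1; rewrite ler_pdivlMr // mul1r ler_nat leq_sub2l.
have := ler_wpM2l (ltW eps0) h1; move: eps0; lra.
Qed.

(** The ratio of steps left is at most [theta^-1], so the growth of the error uses up one of the
    four factors [theta ^+ (24 * h)] of [eps]. *)
Let err_le_cube i : live i -> err i <= 9 / 8 * (theta ^+ (24 * h)) ^+ 3.
Proof.
move=> l; have l0 := live_gt0 _ l.
have ratio : steps_left m / steps_left i <= theta^-1.
  rewrite ler_pdivrMr // ler_pdivlMl //; apply: (le_trans _ l).
  by rewrite ler_wpM2l ?(ltW theta0) // ler_nat leq_subr.
have ratio0 : 0 <= steps_left m / steps_left i by rewrite divr_ge0 // ltW.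
apply: (@le_trans _ _ (9 / 8 * eps * (theta^-1) ^+ (24 * h))).
  rewrite ler_wpM2l ?lerXn2r ?nnegrE ?invr_ge0 ?(ltW theta0) //.
  by move: eps0; lra.
rewrite -mulrA ler_wpM2l ?divr_ge0 // /eps exprVn -exprM.
rewrite ler_pdivrMr ?exprn_gt0 // -exprD.
have -> : (24 * h * 3 + 24 * h = 96 * h)%N by clear; lia.
exact: lexx.
Qed.

Let quarter0 : 0 < theta ^+ (24 * h). Proof. exact: exprn_gt0. Qed.

Let quarter4 : (theta ^+ (24 * h)) ^+ 4 <= 2^-1.
Proof.
rewrite -exprM; have -> : (24 * h * 4 = 96 * h)%N by clear; lia.
exact: eps2.
Qed.

Let err_le i : live i -> err i <= 7 / 10.
Proof.
move/err_le_cube/le_trans; apply.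
set y := theta ^+ (24 * h).
(* Otherwise [y^12 > (3 / 5)^4 = 81 / 625], against [y^12 <= 1 / 8]. *)
suff : y ^+ 3 <= 3 / 5 by lra.
rewrite leNgt; apply/negP => y3.
have : (3 / 5) ^+ 4 < (y ^+ 3) ^+ 4 by rewrite ltrXn2r // divr_ge0.
rewrite -exprM mulnC exprM.
have : (y ^+ 4) ^+ 3 <= (2^-1) ^+ 3.
  by rewrite lerXn2r ?nnegrE ?exprn_ge0 ?invr_ge0 // ltW.
rewrite !exprS !expr0; lra.
Qed.

Lemma err_le_theta i : live i -> err i <= theta.
Proof.
move/err_le_cube/le_trans; apply.
set y := theta ^+ (24 * h).
have yt : y <= theta.
  by rewrite -[leRHS]expr1 ler_wiXn2l ?(ltW theta0) // muln_gt0 (ltnW h2).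
apply: le_trans yt.
(* This absorbs the factor 9 / 8; it holds as [(8 / 9)^2] exceeds 1 / 2. *)
have y2 : y ^+ 2 <= 8 / 9.
  rewrite leNgt; apply/negP => y2.
  have : (8 / 9) ^+ 2 < (y ^+ 2) ^+ 2.
    by rewrite ltrXn2r // divr_ge0.
  rewrite -exprM; move: quarter4; rewrite -/y !exprS !expr0; lra.
have := ler_wpM2l (ltW quarter0) y2; rewrite -/y !exprS expr0; lra.
Qed.

Lemma ok_step i E S : ok i E -> inv i E -> S \in triangles E ->
  inv i.+1 (remove_triangle E S).
Proof.
move=> _ [gE cE mi] ST; split; [exact: is_graph_remove | | exact: leqW].
by have := card_remove_triangle _ _ ST; rewrite cE; clear; lia.
Qed.

(** Supplies the premise of [mean_loss_ge], that doubly counted triangles are negligible. *)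
Let codeg_ge i : live i -> (m <= i)%N -> h%:R <= err i * (dens i ^+ 2 * n%:R).
Proof.
move=> l mi; apply: (le_trans h_small_n).
apply: ler_pM; rewrite ?mulr_ge0 ?exprn_ge0 ?(ltW eps0) ?(ltW theta0) //.
  exact: err_ge.
by rewrite ler_wpM2r // lerXn2r ?nnegrE ?(ltW theta0) ?(ltW (dens_gt0 _ l)) ?dens_ge.
Qed.

Let codeg_gt0 i E : live i -> inv i E -> 0 < density E ^+ 2 * n%:R :> R.
Proof.
by move=> l /density_inv ->; rewrite mulr_gt0 // exprn_gt0 // dens_gt0.
Qed.

Let edges_gt0 i E : live i -> inv i E -> (0 < #|E|)%N.
Proof. by move=> /live_leN iN [_ -> _]; rewrite muln_gt0 subn_gt0. Qed.

Let err_ge0 i : live i -> (m <= i)%N -> 0 <= err i.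
Proof. by move=> l /(err_ge _ l); apply: le_trans; apply: ltW. Qed.

Let err_lt1 i : live i -> err i < 1.
Proof. by move/err_le => e; apply: (le_lt_trans e); lra. Qed.

(** Quasirandomness forces a triangle to exist, so a failure can only be a violated barrier. *)
Lemma quasirandom_ok i E : live i -> inv i E -> quasirandom (err i) h E -> ok i E.
Proof.
move=> l iE q; rewrite /ok q -card_gt0; have [gE _ mi] := iE.
apply: (quasirandom_triangles_gt0 h2 gE q) => //;
  [exact: err_lt1 | exact: codeg_gt0 iE | exact: edges_gt0 iE].
Qed.

Lemma Phi_ge0 i E : 0 <= Phi i E.
Proof. by apply: sumr_ge0 => A _; rewrite addr_ge0 // expR_ge0. Qed.

Lemma Phi_bad i E : live i -> inv i E -> ~~ ok i E -> 1 <= Phi i E.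
Proof.
move=> l iE nok.
have {nok} : ~~ quasirandom (err i) h E.
  by apply: contra nok => /(quasirandom_ok _ _ l iE).
move=> /quasirandomP; apply: contra_notT; rewrite -ltNge => Phi1 A Ah.
rewrite (density_inv _ _ iE).
have term1 x y : x + y <= Phi i E -> 0 <= x -> 0 <= y -> x < 1 /\ y < 1.
  by move=> xy x0 y0; split; apply: le_lt_trans Phi1; lra.
have [] := term1
    (expR (eps / 6 * (#|common_nbhd E A|%:R - (1 + err i) * target i #|A|)))
    (expR (eps / 6 * ((1 - err i) * target i #|A| - #|common_nbhd E A|%:R))).
- rewrite /Phi (bigD1 A) //= lerDl; apply: sumr_ge0 => B _.
  by rewrite addr_ge0 // expR_ge0.
- exact: expR_ge0.
- exact: expR_ge0.
rewrite !expR_lt1 !pmulr_rlt0 ?divr_gt0 // !subr_lt0 => u v.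
by rewrite !ltW.
Qed.

(** The supermartingale inequality holds for each [A] and each barrier separately. *)
Lemma Phi_step i E : live i.+1 -> inv i E -> ok i E ->
  (\sum_(S in triangles E) Phi i.+1 (remove_triangle E S))
    / #|triangles E|%:R <= Phi i E.
Proof.
move=> l1 iE /andP[q ntf]; have l := live_pred _ l1.
have [gE cE mi] := iE; have dE := density_inv _ _ iE.
rewrite /Phi exchange_big /= mulr_suml; apply: ler_sum => A Ah.
rewrite big_split /= mulrDl.
have left1 : steps_left i.+1 = steps_left i - 1.
  by rewrite /steps_left -[1]/(1%:R) -natrB ?subn_gt0 ?live_leN // subnS subn1.
have left_gt0 := live_gt0 _ l.
(* One step multiplies the density by [1 - u], hence the target by [(1 - u) ^+ k] and the error by
   [(1 - u)^-(24 * h)], as in the threshold lemmas with [C = 24 * h]. *)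
pose u : R := (steps_left i)^-1.
have u0 : 0 < u by rewrite invr_gt0.
have left_u : steps_left i.+1 = steps_left i * (1 - u).
  by rewrite left1 mulrBr mulr1 divff // gt_eqF.
have u1 : u < 1.
  by have := live_gt0 _ l1; rewrite left_u pmulr_rgt0 // subr_gt0.
have target1 k : target i.+1 k = target i k * (1 - u) ^+ k.
  by rewrite /target /dens left_u mulrAC exprMn mulrAC.
have err1 : err i.+1 = err i / (1 - u) ^+ (24 * h).
  rewrite /err left_u invfM mulrA exprMn exprVn !mulrA //.
have targ0 : 0 <= target i #|A|.
  by rewrite mulr_ge0 ?exprn_ge0 // ltW // dens_gt0.
have u01 : 0 <= u < 1 by rewrite ltW.
have AC : (#|A| <= 24 * h)%N by apply: (leq_trans Ah); rewrite leq_pmull.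
have e0 := err_ge0 _ l mi.
have e7 : 0 <= err i <= 7 / 10 by rewrite e0 err_le.
have ee : eps <= err i by apply: err_ge.
have kD : 23 * #|A|%:R <= (24 * h - #|A|)%N%:R :> R.
  by rewrite -natrM ler_nat leq_subRL // -mulSn leq_mul2l.
have AhR : #|A|%:R <= h%:R :> R by rewrite ler_nat.
have ku : #|A|%:R * u <= err i.
  apply: le_trans ee; rewrite ler_pdivrMr //; apply: (le_trans AhR).
  by apply: (le_trans h_small_N); rewrite ler_wpM2l // ltW.
have T0 : (0 < #|triangles E|)%N by rewrite card_gt0.
have W0 : 0 <= target i #|A| * u by rewrite mulr_ge0 // ltW.
(* As [#|E| = 3 * (N - i)], the scale of the mean loss is that of the barrier's fall. *)
have WE : 3 * (density E ^+ #|A| * n%:R) / #|E|%:R = target i #|A| * u.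
  rewrite dE cE natrM -/(target i #|A|) /u /steps_left.
  by rewrite -mulf_div divff ?pnatr_eq0 // mul1r.
have c0 := codeg_gt0 _ _ l iE; have E0 := edges_gt0 _ _ l iE.
apply: lerD.
  apply: upper_drift => //; first by rewrite divr_ge0 // ltW.
  rewrite target1 err1; apply: (le_trans (upper_threshold_step _ _ _ _ _ _ _ _ _)) => //.
  rewrite (_ : 6 * (eps / 6) = eps); last by field.
  apply: (upper_drift_margin _ _ _ _ _ _ W0 _ kD ee e7) => //.
    by rewrite divr_ge0.
  rewrite -WE; apply: (mean_loss_ge h2 gE q (err_lt1 _ l) c0 E0 A Ah).
  by rewrite dE; apply: (le_trans AhR); apply: codeg_ge.
apply: lower_drift => //; first by rewrite divr_ge0 // ltW.
  by move: eps2; lra.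
rewrite target1 err1.
apply: (le_trans _ (lower_threshold_step _ _ _ _ _ _ _ _ _)) => //.
rewrite (_ : 6 * (eps / 6) = eps); last by field.
apply: (lower_drift_margin _ _ _ _ _ (err i) _ W0 _ kD _ e7 ku) => //.
  by rewrite ltW.
by rewrite -WE; apply: (mean_loss_le h2 gE q e0 (err_lt1 _ l) c0 E0 A Ah).
Qed.

(** The initial deviation is at most [eps] and the barrier stands at [9 / 8 * eps], so each exponent
    is at most [- (eps / 6) * (eps / 8)] times the target, itself at least [theta ^+ h * n]. *)
Lemma Phi_start G : live m -> inv m G -> quasirandom eps h G ->
  Phi m G <= #|[set A : {set 'I_n} | (#|A| <= h)%N]|%:R *
    (2 * expR (- (eps ^+ 2 * (theta ^+ h * n%:R) / 48))).
Proof.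
move=> l iG /quasirandomP q; rewrite mulr_natl -sumr_const /Phi.
rewrite [leRHS](eq_bigl (fun A : {set 'I_n} => (#|A| <= h)%N)); last first.
  by move=> A; rewrite inE.
apply: ler_sum => A Ah.
have /andP[lo hi] := q A Ah; rewrite (density_inv _ _ iG) in lo hi.
rewrite mulr_natl mulr2n.
have errm : err m = 9 / 8 * eps.
  by rewrite /err divff ?expr1n ?mulr1 // gt_eqF // live_gt0.
have targ : theta ^+ h * n%:R <= target m #|A|.
  rewrite ler_wpM2r //; apply: (@le_trans _ _ (theta ^+ #|A|)).
    by rewrite ler_wiXn2l // ltW.
  by rewrite lerXn2r ?nnegrE ?(ltW theta0) ?(ltW (dens_gt0 _ l)) ?dens_ge.
rewrite -/(target m #|A|) in lo hi.
have e2 : 0 <= eps ^+ 2 * (target m #|A| - theta ^+ h * n%:R).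
  by rewrite mulr_ge0 ?sqr_ge0 // subr_ge0.
have elo := ler_wpM2l (ltW eps0) lo; have ehi := ler_wpM2l (ltW eps0) hi.
by apply: lerD; rewrite ler_expR errm; nra.
Qed.

Lemma traj_fail_le K G : inv m G ->
  traj_Pr m G (fun t : K.-tuple (graph n) => [exists j : 'I_K.+1,
    live (m + j)%N && ~~ ok (m + j)%N (traj m G t (m + j))]) <= Phi m G.
Proof.
apply: (escape_bound live ok inv Phi live_pred Phi_ge0 Phi_bad ok_step _ Phi_step).
by move=> i E /andP[].
Qed.

End Potential.

(** * Asymptotics *)

Lemma bin_le_exp n k : ('C(n, k) <= n ^ k)%N.
Proof.
have ffact_le j : (n ^_ j <= n ^ j)%N.
  elim: j => [|j IH]; first by rewrite ffactn0.
  by rewrite ffactnSr expnSr leq_mul // leq_subr.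
apply: leq_trans (ffact_le k).
by rewrite -bin_ffact leq_pmulr // fact_gt0.
Qed.

Lemma card_small_sets n h : (0 < n)%N ->
  (#|[set A : {set 'I_n} | (#|A| <= h)%N]| <= h.+1 * n ^ h)%N.
Proof.
move=> n0.
have -> : #|[set A : {set 'I_n} | (#|A| <= h)%N]| = (\sum_(k < h.+1) 'C(n, k))%N.
  rewrite -sum1_card.
  rewrite (partition_big (fun A : {set 'I_n} => inord #|A| : 'I_h.+1) predT) //=.
  apply: eq_bigr => k _; rewrite -[n in 'C(n, _)]card_ord -card_draws sum1dep_card.
  apply: eq_card => A; rewrite !inE -val_eqE /=.
  case: (leqP #|A| h) => [Ah|hA]; first by rewrite inordK.
  by symmetry; apply: contraTF hA => /eqP ->; rewrite -leqNgt -ltnS.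
rewrite -[h.+1 in leqRHS]card_ord -sum_nat_const; apply: leq_sum => k _.
by apply: leq_trans (bin_le_exp _ _) _; rewrite leq_pexp2l // -ltnS.
Qed.

(** The congruence makes the integer division in [NN] exact. *)
Lemma bin2_NN n : (n %% 6 == 1)%N || (n %% 6 == 3)%N -> 'C(n, 2) = (3 * NN n)%N.
Proof.
move=> n6; rewrite mulnC divnK //.
have bin2r k : 'C(k.*2.+1, 2) = (k.*2.+1 * k)%N.
  by rewrite bin2 /= mulnC -doubleMl doubleK mulnC.
have := divn_eq n 6; case/orP: n6 => /eqP -> def_n.
  have -> : n = (n %/ 6 * 3).*2.+1 by lia.
  by rewrite bin2r !dvdn_mull.
have -> : n = (n %/ 6 * 3).+1.*2.+1 by lia.
rewrite bin2r dvdn_mulr //.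
have -> : ((n %/ 6 * 3).+1.*2.+1 = (n %/ 6 * 2).+1 * 3)%N by lia.
exact: dvdn_mull.
Qed.

Lemma le_NN n : (7 <= n)%N -> (n <= NN n)%N.
Proof.
move=> n7; rewrite /NN leq_divRL // bin2 -divn2 leq_divRL // -mulnA leq_mul2l.
by lia.
Qed.

(** A single term of the exponential series suffices; its order is [4 * L.+1] because [Y] is only
    known to be at least the fourth root of [n]. *)
Lemma exp_tail_le {R : realType} (L n : nat) (Y : R) :
  0 < Y -> n%:R <= Y ^+ 4 -> (0 < n)%N ->
  expR (- (Y / 48)) <= (4 * L.+1)`!%:R * 48 ^+ (4 * L.+1) / n%:R ^+ L.+1.
Proof.
move=> Y0 nY n0; have n0R : (0 : R) < n%:R by rewrite ltr0n.
have Z0 : 0 < Y / 48 by rewrite divr_gt0.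
rewrite expRN -[leRHS]invrK lef_pV2 ?posrE ?expR_gt0 ?invr_gt0 //; last first.
  by rewrite divr_gt0 ?exprn_gt0 // mulr_gt0 ?exprn_gt0 // ltr0n fact_gt0.
rewrite invf_div; apply: (@le_trans _ _ ((Y / 48) ^+ (4 * L.+1) / (4 * L.+1)`!%:R)).
  rewrite expr_div_n [in leRHS]mulrAC invfM mulrA ler_pM2r ?invr_gt0 ?exprn_gt0 //.
  rewrite ler_pM2r ?invr_gt0 ?ltr0n ?fact_gt0 // exprM.
  by rewrite lerXn2r ?nnegrE // exprn_ge0 // ltW.
have -> : (4 * L.+1 = (4 * L + 3).+1)%N by lia.
have := expR_ge1Dxn (4 * L + 3) (ltW Z0); apply: le_trans.
by rewrite lerDr.
Qed.

(** With [e = theta ^+ (96 * h)], the square of [e^2 * n] is [e^4 * n * n >= n >= h^2]; one factor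
    [e] is then traded for a power of [theta]. *)
Lemma small_order {R : realType} (h n : nat) (theta : R) :
  (2 <= h)%N -> (7 <= n)%N -> (h ^ 2 <= n)%N -> 0 < theta -> theta <= 1 ->
  1 <= (theta ^+ (96 * h)) ^+ 4 * n%:R ->
  h%:R <= theta ^+ (96 * h) * (theta ^+ 2 * n%:R) /\
  h%:R <= theta ^+ (96 * h) * (theta * (NN n)%:R).
Proof.
move=> h2 n7 nh theta0 t1 en; set e := theta ^+ (96 * h) in en *.
have n0 : (0 < n)%N by apply: leq_trans n7.
have n0R : (0 : R) < n%:R by rewrite ltr0n.
have e0 : 0 < e by apply: exprn_gt0.
have te j : (j <= 96 * h)%N -> e <= theta ^+ j.
  by move=> jh; rewrite ler_wiXn2l // ltW.
have hn2 : h%:R <= e ^+ 2 * n%:R.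
  rewrite leNgt; apply/negP => hlt.
  have lt2 : (e ^+ 2 * n%:R) ^+ 2 < h%:R ^+ 2.
    by rewrite ltrXn2r // mulr_ge0 // exprn_ge0 // ltW.
  have h2n : h%:R ^+ 2 <= n%:R :> R by rewrite -natrX ler_nat.
  have := ler_wpM2r (ltW n0R) en; rewrite mul1r.
  have -> : e ^+ 4 * n%:R * n%:R = (e ^+ 2 * n%:R) ^+ 2 by ring.
  lra.
split.
  apply: (le_trans hn2); rewrite expr2 -mulrA ler_wpM2l ?(ltW e0) //.
  by rewrite ler_wpM2r // te // (leq_trans h2) // leq_pmull.
apply: (le_trans hn2); rewrite expr2 -mulrA ler_wpM2l ?(ltW e0) //.
apply: ler_pM; rewrite ?(ltW e0) ?ler_nat ?le_NN //.
by rewrite -[leRHS]expr1 te // muln_gt0 (ltnW h2).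
Qed.

Section FailureProbability.
Context {R : realType} {h : nat}.
Hypothesis h2 : (2 <= h)%N.

(** At most [h.+1 * n^h] sets, each with weight of order [n^-(h + 1)], give [c / n], uniformly in
    [theta], [m] and [G]. *)
Lemma traj_failure_small (delta : R) : 0 < delta ->
  exists n0 : nat, forall n, (n0 <= n)%N ->
    (n %% 6 == 1)%N || (n %% 6 == 3)%N ->
  forall (theta : R) (m : nat) (G : graph n),
    0 < theta -> theta ^+ (96 * h) <= 2^-1 ->
    1 <= (theta ^+ (96 * h)) ^+ 4 * n%:R ->
    is_graph G -> quasirandom (theta ^+ (96 * h)) h G ->
    (#|G| + 3 * m = 3 * NN n)%N ->
  traj_Pr m G (fun t : (NN n - m).-tuple (graph n) =>
    [exists j : 'I_(NN n - m).+1, live (n := n) (theta := theta) (m + j)%N &&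
       ~~ ok (h := h) (m := m) (theta := theta) (m + j)%N (traj m G t (m + j))])
    <= delta.
Proof.
move=> delta0.
pose c : R := 2 * h.+1%:R * ((4 * h.+1)`!%:R * 48 ^+ (4 * h.+1)).
have c0 : 0 <= c / delta.
  by rewrite divr_ge0 ?(ltW delta0) // mulr_ge0 // mulr_ge0 // exprn_ge0.
exists (maxn 7 (maxn (h ^ 2) (Num.bound (c / delta)))) => n.
rewrite !geq_max => /and3P[n7 nh nc] n6 theta m G theta0 e2 en gG qG cG.
set e := theta ^+ (96 * h) in e2 en qG *.
have n0 : (0 < n)%N by apply: leq_trans n7.
have n0R : (0 : R) < n%:R by rewrite ltr0n.
have e0 : 0 < e by apply: exprn_gt0.
have t1 : theta <= 1 by apply: le1_of_expr_le_half e2.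
have te j : (j <= 96 * h)%N -> e <= theta ^+ j.
  by move=> jh; rewrite ler_wiXn2l // ltW.
have [h_n h_N] := small_order h n theta h2 n7 nh theta0 t1 en.
have bN := bin2_NN _ n6.
have invG : inv (m := m) m G.
  by split=> //; rewrite mulnBr -cG addnK.
have [lm|nlm] := boolP (live (n := n) (theta := theta) m); last first.
  rewrite [leLHS](_ : _ = 0) ?(ltW delta0) //; apply: big1_seq => t.
  move=> /andP[/existsP[j /andP[lj _]]]; case/negP: nlm.
  by apply: (le_trans lj); rewrite ler_nat leq_sub2l // leq_addr.
apply: (le_trans (traj_fail_le h2 bN theta0 e2 h_n h_N _ _ invG)).
apply: (le_trans (Phi_start h2 bN theta0 e2 h_N _ lm invG qG)).
(* A lower bound for [e^2 * theta^h * n]; the floor [e^4 * n >= 1] yields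
   [Y^4 = (e^4 * n)^3 * n >= n]. *)
pose Y : R := e ^+ 3 * n%:R.
have Y0 : 0 < Y by rewrite mulr_gt0 // exprn_gt0.
have nY : n%:R <= Y ^+ 4.
  have -> : Y ^+ 4 = (e ^+ 4 * n%:R) ^+ 3 * n%:R by rewrite /Y; ring.
  by rewrite ler_peMl // exprn_ege1.
have le1 : expR (- (e ^+ 2 * (theta ^+ h * n%:R) / 48)) <=
    (4 * h.+1)`!%:R * 48 ^+ (4 * h.+1) / n%:R ^+ h.+1.
  apply: le_trans (exp_tail_le h n Y Y0 nY n0).
  rewrite ler_expR lerN2 ler_wpM2r ?invr_ge0 // /Y mulrA ler_wpM2r //.
  by rewrite exprSr ler_wpM2l ?sqr_ge0 // te // leq_pmull.
have le2 : #|[set A : {set 'I_n} | (#|A| <= h)%N]|%:R <= h.+1%:R * n%:R ^+ h :> R.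
  by rewrite -natrX -natrM ler_nat card_small_sets.
apply: (@le_trans _ _ (h.+1%:R * n%:R ^+ h *
    (2 * ((4 * h.+1)`!%:R * 48 ^+ (4 * h.+1) / n%:R ^+ h.+1)))).
  by apply: ler_pM => //; rewrite ?mulr_ge0 ?expR_ge0 // ler_wpM2l.
have -> : h.+1%:R * n%:R ^+ h *
    (2 * ((4 * h.+1)`!%:R * 48 ^+ (4 * h.+1) / n%:R ^+ h.+1)) = c / n%:R.
  by rewrite /c exprS; field; rewrite expf_neq0 gt_eqF.
rewrite ler_pdivrMr // mulrC -ler_pdivrMr //.
apply: (le_trans (ltW (archi_boundP c0))).
by rewrite ler_nat.
Qed.

End FailureProbability.

(* [n ^ (- 1 / 4)] is a floor on the error parameter, so that the deviations of
   the process, which do not depend on [eps], are absorbed. *)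
Lemma error_parameter {R : realType} (a eps : R) (M n : nat) :
  0 < a -> (0 < M)%N -> (16 <= n)%N -> n%:R `^ (- a) <= eps -> eps < 2^-1 ->
  exists theta : R, [/\ 0 < theta, eps <= theta ^+ M, theta ^+ M <= 2^-1,
    1 <= (theta ^+ M) ^+ 4 * n%:R &
    theta <= eps `^ (M%:R * (1 + 4 * a))^-1].
Proof.
move=> a0 M0 n16 neps eps2.
have n0 : (0 : R) < n%:R by rewrite ltr0n; lia.
have M0R : (0 : R) < M%:R by rewrite ltr0n.
have eps0 : 0 < eps by apply: (lt_le_trans _ neps); apply: powR_gt0.
pose r : R := n%:R `^ (- 4^-1).
have r0 : 0 < r by apply: powR_gt0.
have r4 : r ^+ 4 = n%:R^-1.
  rewrite -powR_mulrn ?(ltW r0) // /r -powRrM -(powR_inv1 (ler0n R n)); congr powR.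
  by field.
have r2 : r <= 2^-1.
  rewrite leNgt; apply/negP => lt_r.
  have : (2^-1) ^+ 4 < r ^+ 4 by rewrite ltrXn2r // invr_ge0.
  rewrite r4 exprVn ltf_pV2 ?posrE ?exprn_gt0 //.
  by rewrite -natrX ltr_nat ltnNge n16.
pose e := Num.max eps r.
have e0 : 0 < e by rewrite lt_max eps0.
exists (e `^ M%:R^-1).
have eM : (e `^ M%:R^-1) ^+ M = e.
  rewrite -powR_mulrn ?powR_ge0 // -powRrM mulVf ?gt_eqF // powRr1 //.
  exact: ltW.
have s0 : 0 < 1 + 4 * a by rewrite addr_gt0 // mulr_gt0.
rewrite eM; split.
- exact: powR_gt0.
- by rewrite le_max lexx.
- by rewrite ge_max (ltW eps2) r2.
- rewrite -ler_pdivrMr // mul1r -r4 lerXn2r ?nnegrE ?(ltW r0) ?(ltW e0) //.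
  by rewrite le_max lexx orbT.
have inv_le : (M%:R * (1 + 4 * a))^-1 <= M%:R^-1.
  rewrite lef_pV2 ?posrE ?mulr_gt0 // ler_peMr ?(ltW M0R) //; lra.
have [re|er] := leP r eps.
  rewrite /e max_l // ger_powR // eps0 /=; lra.
rewrite /e max_r ?(ltW er) //.
(* When the floor exceeds [eps], compare powers of [n] through [eps >= n^(- a)]: the factor
   [1 + 4 * a] makes [a / (M * (1 + 4 * a))] smaller than [1 / (4 * M)]. *)
apply: (@le_trans _ _ ((n%:R `^ (- a)) `^ (M%:R * (1 + 4 * a))^-1)).
  rewrite /r -!powRrM ler_powR //; first by rewrite ler1n; lia.
  rewrite !mulNr lerN2 -subr_ge0.
  have -> : 4^-1 / M%:R - a * (M%:R * (1 + 4 * a))^-1 =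
      4^-1 * (M%:R * (1 + 4 * a))^-1.
    by field; rewrite !gt_eqF.
  by rewrite mulr_ge0 ?invr_ge0 ?mulr_ge0 // ltW.
rewrite ge0_ler_powR ?nnegrE ?powR_ge0 ?invr_ge0 ?mulr_ge0 ?(ltW s0) //.
exact: ltW.
Qed.

(** * From the absence of failures to the theorem *)

(** Every index up to [(1 - theta') * N] is live, hence [ok]: a triangle remains, so the process is
    not frozen, and the error is at most [theta <= theta']. *)
Lemma ok_imp_conclusion {R : realType} {n h m : nat} (theta theta' : R)
    (G : graph n) (t : (NN n - m).-tuple (graph n)) :
  0 < theta -> theta <= theta' -> (m <= NN n)%N ->
  theta ^+ (96 * h) <= 2^-1 ->
  h%:R <= theta ^+ (96 * h) * (theta * (NN n)%:R) -> (2 <= h)%N ->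
  ~~ [exists j : 'I_(NN n - m).+1, live (n := n) (theta := theta) (m + j)%N &&
       ~~ ok (h := h) (m := m) (theta := theta) (m + j)%N (traj m G t (m + j))] ->
  ((1 - theta') * (NN n)%:R <= (freeze_index m G t)%:R) &&
  [forall i : 'I_(NN n).+1,
     ((m <= i)%N && ((i : nat)%:R <= (1 - theta') * (NN n)%:R)) ==>
     quasirandom theta' h (traj m G t i)].
Proof.
move=> theta0 tt mN e2 hN h2 /existsPn okt.
have N0 : (0 : R) <= (NN n)%:R by [].
have okj j : (j <= NN n - m)%N -> (m + j)%:R <= (1 - theta') * (NN n)%:R ->
    live (n := n) (theta := theta) (m + j) /\
    ok (h := h) (m := m) (theta := theta) (m + j)%N (traj m G t (m + j)).
  move=> jK jle.
  have lj : live (n := n) (theta := theta) (m + j).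
    rewrite /live /steps_left natrB; last by rewrite -(subnKC mN) leq_add2l.
    by have := ler_wpM2r N0 tt; lra.
  split=> //; have := okt (Ordinal (jK : (j < (NN n - m).+1)%N)).
  by rewrite lj negbK.
apply/andP; split.
  rewrite leNgt; apply/negP => lt_f.
  pose p j := triangle_free (traj m G t (m + j)).
  (* If nothing is found, [find] returns the length of the list, which puts the freezing index
     beyond [NN n] and contradicts [lt_f]. *)
  have /okj ok_f : (find p (iota 0 (NN n - m).+1) <= NN n - m)%N.
    rewrite leqNgt; apply/negP => f_gt; move: lt_f; apply/negP.
    rewrite -leNgt; apply: (@le_trans _ _ (NN n)%:R).
      by have := ler_wpM2r N0 (le_trans (ltW theta0) tt); lra.
    by rewrite /freeze_index ler_nat -leq_subLR ltnW.
  have [_ /andP[_]] := ok_f (ltW lt_f).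
  have hp : has p (iota 0 (NN n - m).+1).
    rewrite has_find size_iota ltnNge; apply/negP => f_gt.
    move: lt_f; apply/negP; rewrite -leNgt; apply: (@le_trans _ _ (NN n)%:R).
      by have := ler_wpM2r N0 (le_trans (ltW theta0) tt); lra.
    by rewrite /freeze_index ler_nat -leq_subLR ltnW.
  have := nth_find 0%N hp; rewrite nth_iota ?add0n /p => [->//|].
  by rewrite -[X in (_ < X)%N](size_iota 0) -has_find.
apply/forallP => -[i /= iN]; apply/implyP => /andP[mi ile].
have ji : (m + (i - m) = i)%N by rewrite subnKC.
have jK : (i - m <= NN n - m)%N by rewrite leq_sub2r // -ltnS.
have := okj _ jK; rewrite ji => /(_ ile)[li /andP[q _]].
apply: quasirandom_le q; apply: le_trans tt.
by apply: err_le_theta.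
Qed.

(** Choosing [n0] before [eps], [m] and [G] makes the [o(1)] uniform; tuples of length [NN n - m]
    reach every index up to [NN n]. *)
Theorem theorem4p1 (R : realType) (h : nat) (a : R) :
  (2 <= h)%N -> 0 < a ->
  exists b : R, 0 < b /\
  forall delta : R, 0 < delta ->
  exists n0 : nat, forall n : nat, (n0 <= n)%N ->
    (n %% 6 == 1)%N || (n %% 6 == 3)%N ->
  forall (eps : R) (m : nat) (G : graph n),
    (n%:R) `^ (- a) <= eps -> eps < 2^-1 ->
    is_graph G ->
    quasirandom eps h G ->
    (#|G| + 3 * m = 3 * NN n)%N ->
    1 - delta <=
    traj_Pr m G (fun t : (NN n - m).-tuple (graph n) =>
      ((1 - eps `^ b) * (NN n)%:R <= (freeze_index m G t)%:R) &&
      [forall i : 'I_(NN n).+1,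
         ((m <= i)%N && ((i : nat)%:R <= (1 - eps `^ b) * (NN n)%:R)) ==>
         quasirandom (eps `^ b) h (traj m G t i)]).
Proof.
move=> h2 a0.
pose M := (96 * h)%N.
have M0 : (0 < M)%N by rewrite muln_gt0 (ltnW h2).
pose b : R := (M%:R * (1 + 4 * a))^-1.
have b0 : 0 < b.
  by rewrite invr_gt0 mulr_gt0 ?ltr0n // addr_gt0 // mulr_gt0.
exists b; split=> // delta delta0.
have [n0 small] := traj_failure_small h2 delta delta0.
exists (maxn n0 (maxn 16 (h ^ 2))) => n.
rewrite !geq_max => /and3P[nn0 n16 nh] n6 eps m G neps eps2 gG qG cG.
have [theta [theta0 eM M2 Mn tb]] := error_parameter a eps M n a0 M0 n16 neps eps2.
have qG' : quasirandom (theta ^+ M) h G by apply: quasirandom_le qG.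
have fail := small n nn0 n6 theta m G theta0 M2 Mn gG qG' cG.
have mN : (m <= NN n)%N by lia.
rewrite traj_PrC lerD2l lerN2; apply: le_trans fail.
apply: le_traj_Pr => t; apply: contraNT.
have t1 : theta <= 1 by apply: le1_of_expr_le_half M2.
have [_ hN] := small_order h n theta h2 (leq_trans (isT : 7 <= 16)%N n16) nh theta0 t1 Mn.
exact: ok_imp_conclusion.
Qed.
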